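(* Let $(X,d)$ be a metric space with $|X|\ge 2$, let $n$ be an integer with $2\le n\le |X|$, and let $T\colon X\to X$ be a mapping contracting the total pairwise distances between $n$ points with constant $\alpha$ satisfying $0\le\alpha<\frac{1}{n+1}$. Then $T$ is an $n$-point Kannan-type mapping.
   Context: $|X|$ denotes the cardinality of $X$. For points $x_1,\dots,x_n$ of a metric space $(X,d)$ put $S(x_1,\dots,x_n)=\sum_{1\le i<j\le n} d(x_i,x_j)$. A mapping $T\colon X\to X$ is a mapping contracting the total pairwise distances between $n$ points, with constant $\alpha\in[0,1)$, if $S(Tx_1,\dots,Tx_n)\le\alpha\, S(x_1,\dots,x_n)$ for all $n$ pairwise distinct points $x_1,\dots,x_n\in X$. For an integer $n$ with $2\le n\le |X|$, a mapping $T\colon X\to X$ is called an $n$-point Kannan-type mapping if there exists $\lambda\in[0,\frac{n-1}{n})$ such that $S(Tx_1,\dots,Tx_n)\le \lambda\sum_{i=1}^n d(x_i,Tx_i)$ for all pairwise distinct points $x_1,\dots,x_n\in X$. *)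

(* Defs.v *)
From HB Require Import structures.
From mathcomp Require Import all_boot all_order all_algebra.
From mathcomp Require Import boolp classical_sets functions cardinality reals.
From mathcomp Require Import topology.

Set Implicit Arguments.
Unset Strict Implicit.
Unset Printing Implicit Defensive.

Import Order.TTheory GRing.Theory Num.Theory.

Local Open Scope ring_scope.

Definition total_dist (R : realType) (X : metricType R) (n : nat)
    (x : 'I_n -> X) : R :=
  \sum_(i < n) \sum_(j < n | (i < j)%N) mdist (x i) (x j).

Definition contracts_total_dist (R : realType) (X : metricType R) (n : nat)
    (T : X -> X) (alpha : R) : Prop :=
  0 <= alpha < 1 /\
  forall x : 'I_n -> X, injective x ->
    total_dist (fun i => T (x i)) <= alpha * total_dist x.

(* The range 2 <= n <= |X| of the parameter n is not part of this predicate. *)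
Definition kannan_type (R : realType) (X : metricType R) (n : nat)
    (T : X -> X) : Prop :=
  exists lambda : R,
    0 <= lambda < (n%:R - 1) / n%:R /\
    forall x : 'I_n -> X, injective x ->
      total_dist (fun i => T (x i)) <=
        lambda * \sum_(i < n) mdist (x i) (T (x i)).

(* Main.v *)
(* For n points put D = sum d(x_i, T x_i). Summing
   d(x_i, x_j) <= d(x_i, T x_i) + d(T x_i, T x_j) + d(T x_j, x_j) over the pairs,
   each index occurs in n - 1 of them, so S(x) <= (n - 1) D + S(Tx). Contraction
   then gives S(Tx) <= alpha (n - 1) / (1 - alpha) D, and this constant is below
   (n - 1) / n exactly when alpha < 1 / (n + 1). *)
Require Import Defs.
From HB Require Import structures.
From mathcomp Require Import all_boot all_order all_algebra.
From mathcomp Require Import boolp classical_sets functions cardinality reals.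
From mathcomp Require Import topology.
From mathcomp Require Import lra.

Set Implicit Arguments.
Unset Strict Implicit.
Unset Printing Implicit Defensive.

Import Order.TTheory GRing.Theory Num.Theory.

Local Open Scope classical_set_scope.
Local Open Scope card_scope.
Local Open Scope ring_scope.

(** After exchanging the order of summation in the [a j] part, [a i] is collected once for each
    [j > i] and once for each [j < i], hence once for each [j != i]. *)
Lemma sum_pairs_add (V : zmodType) (n : nat) (a : 'I_n -> V) :
  \sum_(i < n) \sum_(j < n | (i < j)%N) (a i + a j) = (\sum_(i < n) a i) *+ n.-1.
Proof.
under eq_bigr do rewrite big_split.
rewrite big_split /= [X in _ + X](exchange_big_dep xpredT) //= -big_split -sumrMnl.
apply: eq_bigr => i _ /=.
have -> : a i *+ n.-1 = \sum_(j < n | j != i) a i.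
  by rewrite sumr_const cardC1 card_ord.
rewrite [RHS](bigID (fun j : 'I_n => (i < j)%N)) /=.
by congr (_ + _); apply: eq_bigl => j; rewrite -val_eqE /=; case: ltngtP.
Qed.

Lemma total_dist_le_image (R : realType) (X : metricType R) (n : nat)
    (T : X -> X) (x : 'I_n -> X) :
  total_dist x <= (\sum_(i < n) mdist (x i) (T (x i))) *+ n.-1
                  + total_dist (fun i => T (x i)).
Proof.
rewrite -sum_pairs_add /total_dist -big_split; apply: ler_sum => i _ /=.
rewrite -big_split; apply: ler_sum => j _ /=.
have h1 := metric_triangle (x i) (T (x i)) (x j).
have h2 := metric_triangle (T (x i)) (T (x j)) (x j).
have h3 := metric_sym (T (x j)) (x j).
lra.
Qed.

Theorem proposition2p5 (R : realType) (X : metricType R) (n : nat)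
    (T : X -> X) (alpha : R)
    (hX : `I_2 #<= [set: X])
    (hn2 : (2 <= n)%N)
    (hnX : `I_n #<= [set: X])
    (halpha : 0 <= alpha < 1 / (n%:R + 1))
    (hT : contracts_total_dist n T alpha) :
  kannan_type n T.
Proof.
case: hT => /andP[a0 a1] hT.
have n2 : (2 : R) <= n%:R by rewrite ler_nat.
have n0 : (0 : R) < n%:R by lra.
have an : alpha * (n%:R + 1) < 1.
  by case/andP: halpha => _; rewrite ltr_pdivlMr //; lra.
exists (alpha * (n%:R - 1) / (1 - alpha)); split.
  apply/andP; split; first by rewrite divr_ge0 ?mulr_ge0 //; lra.
  (* Clearing denominators and cancelling [n - 1 > 0] leaves [alpha * n < 1 - alpha], which is
     [an]. *)
  rewrite ltr_pdivrMr ?subr_gt0 // mulrAC ltr_pdivlMr //.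
  by rewrite mulrAC mulrC ltr_pM2l; lra.
move=> x /hT hx.
(* Scaled by [alpha] and chained with [hx], this gives S(Tx) <= alpha (n - 1) D + alpha S(Tx); the
   last term moves to the left, where the factor [1 - alpha] is positive. *)
have := ler_wpM2l a0 (total_dist_le_image T x).
move: hx; set D := \sum_(i < n) mdist _ _ => hx.
rewrite -[D *+ _]mulr_natr -subn1 natrB ?(ltnW hn2) // => hD.
rewrite mulrAC ler_pdivlMr ?subr_gt0 //; lra.
Qed.
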